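(* Let $X\subseteq\mathcal{A}^{\mathbb{N}^2}$ be an $\mathbb{N}^2$ shift of finite type over a finite alphabet $\mathcal{A}$ that satisfies block gluing with constant $N$, and let $i\ge 1$ be an integer. Then for every $h$ in the closed interval with endpoints $\frac1i\log\lambda_{\mathbf{H}_i(X)}$ and $\frac1i\log\lambda_{\mathbf{V}_i(X)}$ there is $0\le t\le 1$ such that $h$ is realized by the boundary complexity $h^{\mathbf{f}}$ with $f_1(n)=tn-i$ and $f_2(n)=(1-t)n-i$; that is, $$h^{\mathbf{f}}(X)=h=\frac{1-t}{i}\log\lambda_{\mathbf{V}_i(X)}+\frac{t}{i}\log\lambda_{\mathbf{H}_i(X)}.$$
   Context: For real $a,b$, $[a,b]$ as a factor of a lattice set denotes the set of integers between $a$ and $b$. For $F\subseteq\mathbb{N}^2$, $\mathcal{P}(F,X)=\{x|_F:x\in X\}$. For $f_1(n)=tn-i$, $f_2(n)=(1-t)n-i$, the boundary region is $L(n)=[1,tn]\times[1,(1-t)n]\setminus[1,tn-i]\times[1,(1-t)n-i]$ and $h^{\mathbf{f}}(X)=\lim_{n\to\infty}\frac{\log|\mathcal{P}(L(n),X)|}{|L(n)|}$. Let $\mathcal{F}$ be the finite forbidden set defining $X$. The horizontal strip shift $H_i(X)$ is the set of configurations on $\mathbb{N}\times[1,i]$ containing no pattern of $\mathcal{F}$, and the vertical strip shift $V_i(X)$ is the set of configurations on $[1,i]\times\mathbb{N}$ containing no pattern of $\mathcal{F}$; both are regarded as one-dimensional shifts of finite type. $\mathbf{H}_i(X)$ (resp.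 $\mathbf{V}_i(X)$) is the transition matrix of $H_i(X)$ (resp. $V_i(X)$), indexed by vertical (resp. horizontal) patterns of length $i$, and $\lambda_M$ is the largest eigenvalue of the nonnegative matrix $M$; thus $\log\lambda_{\mathbf{H}_i(X)}$ is the entropy $\lim_{n\to\infty}\frac1n\log|\mathcal{P}([1,n]\times[1,i],X)|$ and $\log\lambda_{\mathbf{V}_i(X)}$ is $\lim_{n\to\infty}\frac1n\log|\mathcal{P}([1,i]\times[1,n],X)|$. A block pattern of $X$ is a restriction $x|_R$ of some $x\in X$ to a finite rectangular box $R\subset\mathbb{N}^2$. $X$ satisfies block gluing with constant $N$ if for any two block patterns $u,v$ on rectangular boxes $s(u),s(v)$ with distance $d(s(u),s(v))\ge N$, there is $x\in X$ with $x|_{s(u)}=u$ and $x|_{s(v)}=v$.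
   Formalization: Block patterns are taken up to translation; that log λ of H_i(X), V_i(X) equals the entropy of strip patterns of X is a hypothesis (strip shift and strip patterns grow alike); the outer sides of L(n) are max(tn,i), max((1-t)n,i), so t=0,1 give strips, not empty sets. *)

(* Defs.v *)
From HB Require Import structures.
From mathcomp Require Import all_boot all_order all_algebra.
From mathcomp Require Import finmap.
From mathcomp Require Import all_classical all_reals all_analysis.

Set Implicit Arguments.
Unset Strict Implicit.
Unset Printing Implicit Defensive.

Import Order.TTheory GRing.Theory Num.Theory.
Import numFieldNormedType.Exports.

Local Open Scope classical_set_scope.
Local Open Scope ring_scope.

(* Coordinates are 0-based: the pair (a, b) of naturals stands for the point
   (a + 1, b + 1) of N^2 with N = {1, 2, ...}. *)
Notation site := (nat * nat)%type.

(* [1, m] x [1, k] *)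
Definition box (m k : nat) : {fset site} :=
  ([fset a in iota 0 m] `*` [fset b in iota 0 k])%fset.

(* [1, a] x [1, b] for real a, b; it is empty as soon as a < 1 or b < 1,
   because truncn is the floor on nonnegative reals and 0 elsewhere. *)
Definition real_box (R : realType) (a b : R) : {fset site} :=
  box (Num.truncn a) (Num.truncn b).

(* L(n) = [1, tn] x [1, (1-t)n] \ [1, tn-i] x [1, (1-t)n-i].
   The outer sides are written max(tn - i, 0) + i, i.e. max(tn, i), and
   likewise for (1-t)n. If 0 < t < 1 this changes nothing once tn >= i and
   (1-t)n >= i, hence nothing in the limit. If t = 0 or t = 1 the set without
   the maximum is empty for every n, so that the quotient defining the
   boundary complexity would be 0 / 0; here it is the strip
   [1, i] x [1, n], resp. [1, n] x [1, i], for n >= i. *)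
Definition boundary_region (R : realType) (t : R) (i n : nat) : {fset site} :=
  (real_box (Num.max (t * n%:R) i%:R) (Num.max ((1 - t) * n%:R) i%:R)
   `\` real_box (t * n%:R - i%:R) ((1 - t) * n%:R - i%:R))%fset.

Section Shifts.
Variable A : finType.

(* P(D, X) *)
Definition patterns (D : {fset site}) (X : set (site -> A)) :
    {set {ffun D -> A}} :=
  [set u : {ffun D -> A} | `[< exists2 x, X x & forall s : D, x (val s) = u s >]]%SET.

Definition boundary_rate (R : realType) (t : R) (i : nat)
    (X : set (site -> A)) : R^nat :=
  fun n => ln (#|patterns (boundary_region t i n) X|%:R)
             / #|` boundary_region t i n|%:R.

(* A pattern is a finite partial map p. It occurs in the partial configuration
   g (None where undefined) if some translate of p, with its whole support in
   the domain of g, agrees with g; the site s of p is matched with the site r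
   of g given by r = s + u - w. *)
Definition occurs (p : {fmap site -> A}) (g : site -> option A) : Prop :=
  exists u w : site, forall s, s \in domf p ->
    exists r : site, r + w = s + u /\ g r = p.[? s]%fmap.

Definition admissible (F : {fset {fmap site -> A}}) (g : site -> option A) :
    Prop :=
  forall p, p \in F -> ~ occurs p g.

Definition sft (F : {fset {fmap site -> A}}) : set (site -> A) :=
  [set x | admissible F (fun s => Some (x s))].

(* The m x k array u is seen in x at the box whose least corner is v. *)
Definition appears_at m k (u : {ffun 'I_m * 'I_k -> A}) (v : site)
    (x : site -> A) : Prop :=
  forall s : 'I_m * 'I_k, x (v.1 + s.1, v.2 + s.2)%N = u s.

(* Patterns are taken up to translation, as usual in symbolic dynamics: an
   array is a block pattern of X if it appears anywhere in a point of X. *)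
Definition block_pattern (X : set (site -> A)) m k
    (u : {ffun 'I_m * 'I_k -> A}) : Prop :=
  exists2 x, X x & exists v, appears_at u v x.

Definition site_dist (r s : site) : nat :=
  maxn ((r.1 - s.1) + (s.1 - r.1)) ((r.2 - s.2) + (s.2 - r.2)).

Definition block_gluing (N : nat) (X : set (site -> A)) : Prop :=
  forall (m k m' k' : nat)
    (u : {ffun 'I_m * 'I_k -> A}) (u' : {ffun 'I_m' * 'I_k' -> A})
    (v v' : site),
    block_pattern X u -> block_pattern X u' ->
    (forall (s : 'I_m * 'I_k) (s' : 'I_m' * 'I_k'),
       (N <= site_dist (v.1 + s.1, v.2 + s.2)%N
                       (v'.1 + s'.1, v'.2 + s'.2)%N)%N) ->
    exists2 x, X x & appears_at u v x /\ appears_at u' v' x.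

Inductive direction := horizontal | vertical.

(* Swaps the coordinates for vertical strips: the first coordinate of the
   result is the position along the strip, the second one the position across. *)
Definition along (d : direction) (s : site) : site :=
  if d is horizontal then s else (s.2, s.1).

(* The partial configuration on the strip of width i in direction d whose k-th
   cross-section is c k (absent if c k = None). *)
Definition stack (d : direction) (i : nat)
    (c : nat -> option {ffun 'I_i -> A}) (s : site) : option A :=
  if c (along d s).1 is Some y then omap y (insub (along d s).2) else None.

(* H_i(X) and V_i(X), as one-dimensional shifts over the alphabet A^i *)
Definition strip_shift (F : {fset {fmap site -> A}}) (d : direction) (i : nat) :
    set (nat -> {ffun 'I_i -> A}) :=
  [set y | admissible F (stack d (fun k => Some (y k)))].

(* words of length n that start a sequence of S *)
Definition language (B : finType) (S : set (nat -> B)) (n : nat) :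
    {set n.-tuple B} :=
  [set w : n.-tuple B | `[< exists2 y, S y & forall k : 'I_n, y k = tnth w k >]]%SET.

(* the largest width minus one, in direction d, of a pattern of F *)
Definition extent (F : {fset {fmap site -> A}}) (d : direction) : nat :=
  (\max_(p <- F) \max_(s <- domf p) \max_(s' <- domf p)
     ((along d s).1 - (along d s').1))%N.

(* The strip shifts are SFTs with forbidden words of length at most
   extent F d + 1. If this is at most 2 the memory is 1 and the transition
   matrix is indexed by A^i; otherwise one uses the higher block presentation. *)
Definition memory (F : {fset {fmap site -> A}}) (d : direction) : nat :=
  maxn 1 (extent F d).

Definition transition (F : {fset {fmap site -> A}}) (d : direction) (i m : nat)
    (a b : m.-tuple {ffun 'I_i -> A}) : bool :=
  [exists w : m.+1.-tuple {ffun 'I_i -> A},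
     [&& take m w == a, behead w == b &
         `[< admissible F (stack d (onth w)) >]]].

Definition transition_matrix (R : realType) (F : {fset {fmap site -> A}})
    (d : direction) (i : nat) :
    'M[R]_#|{: (memory F d).-tuple {ffun 'I_i -> A}}| :=
  \matrix_(a, b) (transition F d (enum_val a) (enum_val b))%:R.

(* [1, n] x [1, i], resp. [1, i] x [1, n] *)
Definition strip_box (d : direction) (i n : nat) : {fset site} :=
  if d is horizontal then box n i else box i n.

(* The strip shift, defined by forbidding F inside the strip only, has the same
   entropy as the patterns of X in [1, n] x [1, i], resp. [1, i] x [1, n]. This
   may fail when admissible strip configurations do not extend to X. *)
Definition strip_entropy_agrees (R : realType) (F : {fset {fmap site -> A}})
    (d : direction) (i : nat) : Prop :=
  (fun n : nat => (ln (#|patterns (strip_box d i n) (sft F)|%:R)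
                   - ln (#|language (@strip_shift F d i) n|%:R)) / n%:R : R)
    @ \oo --> (0 : R).

End Shifts.

(* The largest real eigenvalue; by Perron-Frobenius this is the spectral radius
   when M is nonnegative of positive size, so the supremum is a maximum. *)
Definition largest_eigenvalue (R : realType) n (M : 'M[R]_n) : R :=
  sup [set a | eigenvalue M a].

(* Main.v *)
(** The region L(n) is the union of a horizontal strip of length m ~ tn and a
    vertical strip of length k ~ (1-t)n, both of width i. A pattern on L(n) is
    determined by its two restrictions; conversely, shortening the vertical
    strip by N makes the two strips far enough apart for block gluing to combine
    arbitrary patterns on them. Hence log|P(L(n))| is asymptotically linear in n
    with slope t log(lambda_H) + (1-t) log(lambda_V), while |L(n)| ~ in.

    The growth rate of the words of a strip shift is the logarithm of the
    largest eigenvalue of its transition matrix M by a Perron-Frobenius argument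
    for p_n = |M^n|_1. The sequence log p_n is subadditive, with rate L, and no
    eigenvalue exceeds e^L. If e^L were not an eigenvalue, the geometric sum of
    the powers of M would make p_n / e^(nL) grow exponentially, contradicting
    the choice of L. *)

Require Import Defs.
From HB Require Import structures.
From mathcomp Require Import all_boot all_order all_algebra.
From mathcomp Require Import finmap.
From mathcomp Require Import all_classical all_reals all_analysis.
From mathcomp Require Import ring lra zify.
Import Order.TTheory GRing.Theory Num.Theory.
Import numFieldNormedType.Exports.
Local Open Scope classical_set_scope.
Local Open Scope ring_scope.

(** * Sequences of the form [L n + o(n)] *)

Section AsymptoticallyLinear.
Context {R : realType}.
Implicit Types (u v w : nat -> R) (L M : R).

(** Convergence of [u n / n] to [L], without division: the additive constant [C] replaces a
    threshold on [n], so sums and reindexings combine by plain inequalities valid for every [n]. *)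
Definition asymp_linear u L :=
  forall e, 0 < e -> exists C, forall n, `|u n - L * n%:R| <= e * n%:R + C.

Lemma asymp_linear_cvg u L :
  asymp_linear u L <-> (u n / n%:R @[n --> \oo] --> L).
Proof.
split=> [uL|/cvgrPdist_le uL e e0].
  apply/cvgrPdist_le => e e0.
  have [|C uC] := uL (e / 2); first by rewrite divr_gt0.
  near=> n.
  have n0 : 0 < n%:R :> R by rewrite ltr0n; near: n; exists 1%N.
  have -> : L - u n / n%:R = - ((u n - L * n%:R) / n%:R).
    by field; rewrite lt0r_neq0.
  rewrite normrN normrM [X in _ * X]gtr0_norm ?invr_gt0// ler_pdivrMr//.
  apply: le_trans (uC n) _.
  have : C / (e / 2) <= n%:R.
    near: n; exists (Num.truncn (C / (e / 2))).+1 => // n /=.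
    rewrite -(ler_nat R) => /(le_trans _); apply.
    by apply: ltW; apply: truncnS_gt.
  rewrite ler_pdivrMr ?divr_gt0//; lra.
have [N _ uN] := uL e e0.
exists (\sum_(j < N.+1) `|u j - L * j%:R|) => n.
have [nN|Nn] := ltnP n N.+1.
  rewrite (bigD1 (Ordinal nN))//= addrA ler_wpDr ?sumr_ge0// ler_wpDl//.
  by rewrite mulr_ge0// ltW.
have n0 : 0 < n%:R :> R by rewrite ltr0n (leq_trans _ Nn).
rewrite ler_wpDr ?sumr_ge0//.
have -> : u n - L * n%:R = - ((L - u n / n%:R) * n%:R).
  by field; rewrite lt0r_neq0.
by rewrite normrN normrM normr_nat ler_wpM2r// uN//= ltnW.
Unshelve. all: by end_near.
Qed.

(** Fekete's lemma. The rate is the infimum of [u n / n], whence the lower bound at every [n]; the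
    upper bound comes from division with remainder by a nearly optimal index. *)
Lemma fekete u : (forall m n, u (m + n)%N <= u m + u n) ->
  (forall n, 0 <= u n) ->
  exists L, asymp_linear u L /\ forall n, L * n%:R <= u n.
Proof.
move=> sub u0; pose S : set R := [set u n.+1 / n.+1%:R | n in setT].
have S0 : S !=set0 by exists (u 1%N / 1); exists 0%N.
have lbS : lbound S 0 by move=> _ [n _ <-]; rewrite divr_ge0.
have hiS : has_inf S by split=> //; exists 0.
have L0 : 0 <= inf S by apply: lb_le_inf.
have Lu n : inf S * n%:R <= u n.
  case: n => [|n]; first by rewrite mulr0.
  rewrite -ler_pdivlMr ?ltr0n//; apply: ge_inf; [by exists 0|by exists n].
exists (inf S); split=> // e e0.
have [_ [N _ <-] uN] := inf_adherent e0 hiS.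
have {}uN : u N.+1 <= (inf S + e) * N.+1%:R.
  by rewrite -ler_pdivrMr ?ltr0n//; apply: ltW.
have mulu q r : u (q * N.+1 + r)%N <= q%:R * u N.+1 + u r.
  elim: q => [|q IH]; first by rewrite mul0n add0n mul0r add0r.
  rewrite mulSn -addnA (le_trans (sub _ _))// -natr1; lra.
exists (\sum_(r < N.+1) u r) => n.
rewrite ger0_norm ?subr_ge0//.
rewrite {1}(divn_eq n N.+1) lerBlDr (le_trans (mulu _ _))// addrAC lerD//; last first.
  by rewrite (bigD1 (Ordinal (ltn_pmod n (ltn0Sn N))))//= ler_wpDr ?sumr_ge0.
rewrite (le_trans (ler_wpM2l _ uN))// mulrCA addrC -mulrDl ler_wpM2l//.
  by rewrite addr_ge0// ltW.
by rewrite -natrM ler_nat leq_divM.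
Qed.

Lemma asymp_linearD u v L M : asymp_linear u L -> asymp_linear v M ->
  asymp_linear (fun n => u n + v n) (L + M).
Proof.
move=> uL vM e e0; have e2 : 0 < e / 2 by rewrite divr_gt0.
have [[C uC] [D vD]] := (uL _ e2, vM _ e2); exists (C + D) => n.
have -> : u n + v n - (L + M) * n%:R = (u n - L * n%:R) + (v n - M * n%:R) by ring.
by rewrite (le_trans (ler_normD _ _))// (le_trans (lerD (uC n) (vD n)))//; lra.
Qed.

Lemma asymp_linear_squeeze u v w L : asymp_linear u L -> asymp_linear w L ->
  (forall n, u n <= v n <= w n) -> asymp_linear v L.
Proof.
move=> uL wL uvw e e0; have [[C uC] [D wD]] := (uL _ e0, wL _ e0).
exists (`|C| + `|D|) => n; have /andP[uv vw] := uvw n.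
have := uC n; have := wD n; rewrite !ler_norml => /andP[_ w1] /andP[u1 _].
have := ler_norm C; have := ler_norm D.
have := normr_ge0 C; have := normr_ge0 D => *.
by apply/andP; split; lra.
Qed.

Lemma asymp_linear_bounded u L C :
  (forall n, `|u n - L * n%:R| <= C) -> asymp_linear u L.
Proof.
move=> uC e e0; exists C => n; rewrite (le_trans (uC n))// lerDr.
by rewrite mulr_ge0// ltW.
Qed.

(** Since [f n] is at most [(|x| + 1) n + C], the tolerance for [u] is divided by [|x| + 1]. *)
Lemma asymp_linear_comp u L (f : nat -> nat) x C : asymp_linear u L ->
  (forall n, `|(f n)%:R - x * n%:R| <= C) -> asymp_linear (u \o f) (L * x).
Proof.
move=> uL fx e e0; have x1 : 0 < `|x| + 1 by rewrite ltr_wpDl.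
have [|D uD] := uL (e / (`|x| + 1)); first by rewrite divr_gt0.
exists (e / (`|x| + 1) * C + D + `|L| * C) => n /=.
have -> : u (f n) - L * x * n%:R =
    (u (f n) - L * (f n)%:R) + L * ((f n)%:R - x * n%:R) by ring.
rewrite (le_trans (ler_normD _ _))// normrM addrA lerD//; last by rewrite ler_wpM2l.
rewrite (le_trans (uD _))// addrA lerD2r.
have -> : e * n%:R = e / (`|x| + 1) * ((`|x| + 1) * n%:R) by field; rewrite lt0r_neq0.
rewrite -mulrDr ler_wpM2l//; first by rewrite divr_ge0// ltW.
have := ler_norm ((f n)%:R - x * n%:R); have := fx n; have := ler_norm x.
by have := ler0n R n; nra.
Qed.

(** Transfers a rate between logarithms of counts that bound each other up to a constant factor and
    index shifts. *)
Lemma asymp_linear_sandwich u v L (C : R) (a b c : nat) :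
  (forall n, u (n + a)%N <= v n + C) -> (forall n, v (n + b)%N <= u (n + c)%N + C) ->
  asymp_linear v L -> asymp_linear u L.
Proof.
move=> uv vu vL e e0; have [D vD] := vL e e0.
(* The sum absorbs the indices below [a + c], where [n - a] or [n - c] could truncate; the last term
   pays for the index shifts. *)
exists (\sum_(j < (a + c)%N) `|u j - L * j%:R| + `|C| + `|D| +
        (`|L| + e) * (a + b + c)%:R) => n.
have big0 : 0 <= \sum_(j < (a + c)%N) `|u j - L * j%:R| by rewrite sumr_ge0.
have e1 : 0 <= e * n%:R by rewrite mulr_ge0// ltW.
have e2 : 0 <= (`|L| + e) * (a + b + c)%:R by rewrite mulr_ge0// addr_ge0// ltW.
have [nac|acn] := ltnP n (a + c).
  have : `|u n - L * n%:R| <= \sum_(j < (a + c)%N) `|u j - L * j%:R|.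
    by rewrite (bigD1 (Ordinal nac))//= ler_wpDr// sumr_ge0.
  have := normr_ge0 C; have := normr_ge0 D; lra.
have La : `|L * a%:R| <= `|L| * a%:R by rewrite normrM normr_nat.
have Lb : `|L * b%:R| <= `|L| * b%:R by rewrite normrM normr_nat.
have Lc : `|L * c%:R| <= `|L| * c%:R by rewrite normrM normr_nat.
have [a1 b1 c1] : [/\ 0 <= e * a%:R, 0 <= e * b%:R & 0 <= e * c%:R].
  by split; rewrite mulr_ge0// ltW.
have [an cn] : (a <= n)%N /\ (c <= n)%N by clear -acn; lia.
have := ler_norm C; have := ler_norm D.
have := uv (n - a)%N; have := vu (n - c)%N; rewrite (subnK an) (subnK cn).
have := vD (n - a)%N; have := vD (n - c + b)%N.
rewrite natrD (natrB _ an) (natrB _ cn) !natrD.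
move: a1 b1 c1 La Lb Lc big0 (normr_ge0 C) (normr_ge0 D).
rewrite !ler_norml.
move: (\sum_(j < _) _) => S.
have := normr_ge0 (L * a%:R).
have := normr_ge0 (L * b%:R).
have := normr_ge0 (L * c%:R).
rewrite !normrM !normr_nat.
clear; move=> ? ? ? ? ? ? /andP[? ?] /andP[? ?] /andP[? ?] ? ? ? /andP[? ?] /andP[? ?] ? ? ? ?.
by apply/andP; split; lra.
Qed.

End AsymptoticallyLinear.

(** * Growth of powers of a nonnegative matrix *)

Section PerronFrobenius.
Context {R : realType}.

(** This norm is submultiplicative, additive on nonnegative matrices, and counts paths on powers of
    an adjacency matrix. *)
Definition mxnorm1 {m n} (A : 'M[R]_(m, n)) : R := \sum_i \sum_j `|A i j|.

Lemma mxnorm1_ge0 m n (A : 'M[R]_(m, n)) : 0 <= mxnorm1 A.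
Proof. by rewrite sumr_ge0// => i _; rewrite sumr_ge0. Qed.

Lemma mxnorm1D m n (A B : 'M[R]_(m, n)) : mxnorm1 (A + B) <= mxnorm1 A + mxnorm1 B.
Proof.
rewrite /mxnorm1 -big_split ler_sum// => i _ /=.
by rewrite -big_split ler_sum// => j _; rewrite mxE ler_normD.
Qed.

Lemma mxnorm1Z m n c (A : 'M[R]_(m, n)) : mxnorm1 (c *: A) = `|c| * mxnorm1 A.
Proof.
rewrite /mxnorm1 mulr_sumr; apply: eq_bigr => i _.
by rewrite mulr_sumr; apply: eq_bigr => j _; rewrite mxE normrM.
Qed.

Lemma mxnorm1M m n p (A : 'M[R]_(m, n)) (B : 'M[R]_(n, p)) :
  mxnorm1 (A *m B) <= mxnorm1 A * mxnorm1 B.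
Proof.
rewrite /mxnorm1 mulr_suml ler_sum// => i _.
apply: (@le_trans _ _ (\sum_j \sum_k `|A i k| * `|B k j|)).
  rewrite ler_sum// => j _; rewrite mxE (le_trans (ler_norm_sum _ _ _))//.
  by apply: ler_sum => k _; rewrite normrM.
rewrite exchange_big mulr_suml ler_sum// => k _ /=.
rewrite -mulr_sumr ler_wpM2l// (bigD1 k)//= ler_wpDr// sumr_ge0// => l _.
by rewrite sumr_ge0.
Qed.

Lemma mxnorm1_eq0 m n (A : 'M[R]_(m, n)) : mxnorm1 A = 0 -> A = 0.
Proof.
move=> /eqP; rewrite psumr_eq0 => [/allP A0|i _]; last by rewrite sumr_ge0.
apply/matrixP => i j; rewrite mxE; apply/eqP; rewrite -normr_eq0.
have := A0 i (mem_index_enum _); rewrite implyTb psumr_eq0 => [/allP Ai|//].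
by have := Ai j (mem_index_enum _).
Qed.

(** Take norms in [v *m M ^+ n = a ^+ n *: v] for a row eigenvector [v] and cancel the norm of
    [v]. *)
Lemma eigenvalue_le_mxnorm1 d (M : 'M[R]_d) (a : R) n :
  eigenvalue M a -> `|a| ^+ n <= mxnorm1 (M ^+ n).
Proof.
move=> /eigenvalueP[v vM v0].
have vMn : v *m M ^+ n = a ^+ n *: v.
  elim: n => [|n IH]; first by rewrite !expr0 scale1r mulmx1.
  by rewrite !exprSr [M ^+ n * M]/(_ *m M) mulmxA IH -scalemxAl vM scalerA.
have vgt0 : 0 < mxnorm1 v.
  by rewrite lt_def mxnorm1_ge0 andbT; apply: contra_neq v0 => /mxnorm1_eq0.
by rewrite -(ler_pM2l vgt0) mulrC -normrX -mxnorm1Z -vMn mxnorm1M.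
Qed.

(** Serves the case of an empty shift. If there is no real eigenvalue at all, the supremum of the
    empty set is 0 by convention. *)
Lemma largest_eigenvalue_nilpotent d (M : 'M[R]_d) n :
  M ^+ n = 0 -> largest_eigenvalue M = 0.
Proof.
move=> Mn0; rewrite /largest_eigenvalue.
have sub : [set a | eigenvalue M a] `<=` [set 0].
  move=> a /(eigenvalue_le_mxnorm1 _ _ _ n).
  rewrite Mn0 /mxnorm1 big1 => [|i _]; last by rewrite big1// => j _; rewrite mxE normr0.
  rewrite -normrX normr_le0 expf_eq0 => /andP[_ /eqP].
  by [].
have [->|/set0P[a ea]] := eqVneq [set a | eigenvalue M a] set0; first exact: sup0.
have -> : [set a | eigenvalue M a] = [set 0].
  by apply/seteqP; split=> // _ ->; rewrite -(sub a ea).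
exact: sup1.
Qed.

(** The telescoping geometric sum, in homogeneous form to avoid powers of the inverse of [x]. *)
Lemma geometric_mx d (M : 'M[R]_d) (x : R) K :
  (x%:M - M) *m \sum_(n < K) x ^+ (K - n.+1) *: M ^+ n = (x ^+ K)%:M - M ^+ K.
Proof.
elim: K => [|K IH]; first by rewrite big_ord0 mulmx0 !expr0 subrr.
rewrite big_ord_recr /= subnn expr0 scale1r mulmxDr.
under eq_bigr => j _ do rewrite subSn// exprS -scalerA.
rewrite -scaler_sumr -scalemxAr IH scalerBr mulmxBl mul_scalar_mx exprS.
rewrite [M ^+ K.+1]exprS scale_scalar_mx -/(M * _)%R addrA subrK.
by [].
Qed.

Section nonnegative.
Variables (d : nat) (M : 'M[R]_d).
Hypothesis M_ge0 : forall a b, 0 <= M a b.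

Lemma exprmx_ge0 n a b : 0 <= (M ^+ n) a b.
Proof.
elim: n a b => [|n IH] a b; first by rewrite expr0 mxE ler0n.
by rewrite exprS mxE sumr_ge0// => k _; rewrite mulr_ge0.
Qed.

Lemma mxnorm1_sum_exprmx (x : R) K : 0 <= x ->
  mxnorm1 (\sum_(n < K) x ^+ (K - n.+1) *: M ^+ n) =
  \sum_(n < K) x ^+ (K - n.+1) * mxnorm1 (M ^+ n).
Proof.
move=> x0; rewrite /mxnorm1.
under [RHS]eq_bigr => n _ do rewrite mulr_sumr.
rewrite [RHS]exchange_big; apply: eq_bigr => a _ /=.
under [RHS]eq_bigr => n _ do rewrite mulr_sumr.
rewrite [RHS]exchange_big; apply: eq_bigr => b _ /=.
rewrite ger0_norm summxE; last first.
  by apply: sumr_ge0 => n _; rewrite mxE mulr_ge0 ?exprn_ge0 ?exprmx_ge0.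
by apply: eq_bigr => n _; rewrite mxE ger0_norm ?exprmx_ge0.
Qed.

Hypothesis norm_ge1 : forall n, 1 <= mxnorm1 (M ^+ n).

Let p n := mxnorm1 (M ^+ n).
Let p_gt0 n : 0 < p n. Proof. exact: lt_le_trans (norm_ge1 n). Qed.

(* If [x - M] is invertible, the geometric sum identity bounds the sum of the
   first K values of [q n = p n / x ^ n] by a multiple of [1 + q K], so that q
   grows exponentially. *)
Lemma invertible_exponential_growth (x : R) : 0 < x ->
  x%:M - M \in unitmx -> (forall n, x ^+ n <= p n) ->
  exists c r K0, [/\ 0 < c, 1 < r &
    forall K, c * r ^+ K * x ^+ (K0 + K) <= p (K0 + K)].
Proof.
move=> x0 xM_unit xp.
pose q n := p n / x ^+ n; pose Q K := \sum_(n < K) q n.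
have xn0 n : 0 < x ^+ n by rewrite exprn_gt0.
have q_ge1 n : 1 <= q n by rewrite ler_pdivlMr// mul1r.
have QS K : Q K.+1 = Q K + q K by rewrite /Q big_ord_recr.
have Q_ge K : K%:R <= Q K.
  elim: K => [|K IH]; first by rewrite /Q big_ord0.
  by rewrite QS -natr1 lerD.
(* The first two factors bound the inverse of [x - M] and the identity, with [+ 1] for positivity;
   the factor [x] offsets the exponent [K - n.+1] of the geometric sum. *)
pose C := (mxnorm1 (invmx (x%:M - M)) + 1) * (mxnorm1 (1%:M : 'M[R]_d) + 1) * x.
have C0 : 0 < C.
  by rewrite !mulr_gt0// ltr_wpDl ?mxnorm1_ge0.
have bound K : Q K <= C * (1 + q K).
  have /(congr1 (fun Y => invmx (x%:M - M) *m Y)) := geometric_mx _ M x K.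
  rewrite mulmxA mulVmx// mul1mx => /(congr1 mxnorm1).
  rewrite mxnorm1_sum_exprmx; last exact: ltW.
  have -> : \sum_(n < K) x ^+ (K - n.+1) * mxnorm1 (M ^+ n) = Q K * x ^+ K / x.
    rewrite /Q !mulr_suml; apply: eq_bigr => n _.
    have -> : x ^+ K = x ^+ (K - n.+1) * x ^+ n * x.
      by rewrite -mulrA -exprSr -exprD subnK.
    by rewrite /q -/(p n); field; rewrite !lt0r_neq0.
  move=> QK; rewrite -(ler_pM2r (xn0 K)) -(ler_pM2r (_ : 0 < x^-1)) ?invr_gt0//.
  rewrite QK (le_trans (mxnorm1M _ _ _ _ _))//.
  have -> : C * (1 + q K) * x ^+ K / x =
    (mxnorm1 (invmx (x%:M - M)) + 1) *
    ((mxnorm1 (1%:M : 'M[R]_d) + 1) * (x ^+ K + p K)).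
    by rewrite /C /q; field; rewrite !lt0r_neq0.
  apply: ler_pM; rewrite ?mxnorm1_ge0//; first by rewrite lerDl.
  rewrite (le_trans (mxnorm1D _ _ _ _))// -scaleN1r mxnorm1Z normrN1 mul1r.
  rewrite -[(x ^+ K)%:M]scalemx1 mxnorm1Z ger0_norm; last exact: ltW.
  have := mxnorm1_ge0 _ _ (1%:M : 'M[R]_d).
  have := p_gt0 K; have := xn0 K; rewrite -/(p K).
  move: (mxnorm1 _) (x ^+ K) (p K) => u v w v0 w0 u0.
  by rewrite mulrDr mulrDl mul1r [u * v]mulrC; nra.
(* From [bound], [q K >= Q K / C - 1 >= Q K / (2 C)] once [Q K >= 2 C]. *)
pose c := (2 * C)^-1; have c0 : 0 < c by rewrite invr_gt0 mulr_gt0.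
pose K0 := (Num.truncn (2 * C)).+1.
have K0C : 2 * C <= K0%:R by apply/ltW/truncnS_gt.
have qQ K : (K0 <= K)%N -> c * Q K <= q K.
  move=> K0K; have QC : 2 * C <= Q K.
    by rewrite (le_trans K0C)// (le_trans _ (Q_ge K))// ler_nat.
  rewrite /c mulrC ler_pdivrMr; last by rewrite mulr_gt0.
  by have := bound K; lra.
have Qr K : (1 + c) ^+ K <= Q (K0 + K)%N.
  elim: K => [|K IH]; first by rewrite addn0 (le_trans _ (Q_ge _))// ler1n.
  rewrite addnS QS exprSr (le_trans _ (lerD (lexx _) (qQ _ (leq_addr _ _))))//.
  have -> : Q (K0 + K)%N + c * Q (K0 + K)%N = Q (K0 + K)%N * (1 + c) by ring.
  by rewrite ler_wpM2r// addr_ge0// ltW.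
exists c, (1 + c), K0; split=> [//||K]; first by rewrite ltrDl.
rewrite -ler_pdivlMr// (le_trans _ (qQ _ (leq_addr _ _)))//.
by rewrite ler_wpM2l// ltW.
Qed.

(** Fekete's lemma supplies the rate [L]; [expR L] is then shown to bound all eigenvalues and to be
    one. *)
Lemma perron_frobenius_rate :
  asymp_linear (fun n => ln (p n)) (ln (largest_eigenvalue M)).
Proof.
have [||L [pL Lp]] := fekete (fun n => ln (p n)).
- move=> m n; rewrite -lnM ?posrE// ler_ln ?posrE ?mulr_gt0// /p exprD; exact: mxnorm1M.
- by move=> n; apply: ln_ge0; exact: norm_ge1.
suff -> : largest_eigenvalue M = expR L by rewrite expRK.
have rho_p n : expR L ^+ n <= p n.
  by rewrite -expRM_natr -[leRHS]lnK ?posrE// ler_expR.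
have ev_le a : eigenvalue M a -> a <= expR L.
  move=> ea; rewrite leNgt; apply/negP => La.
  have a0 : 0 < a by rewrite (lt_trans _ La) ?expR_gt0.
  have La' : L < ln a by rewrite -ltr_expR lnK.
  have [|C pC] := pL ((ln a - L) / 2); first by rewrite divr_gt0// subr_gt0.
  (* Large enough that the excess [(ln a - L) n] beats the allowed error, which has half that slope
     plus [C]. *)
  pose n := (Num.truncn (C / ((ln a - L) / 2))).+1.
  have nC : C / ((ln a - L) / 2) < n%:R by apply: truncnS_gt.
  have := pC n; have := eigenvalue_le_mxnorm1 _ _ _ n ea.
  rewrite gtr0_norm// -/(p n) -[leLHS]lnK ?posrE ?exprn_gt0//.
  rewrite -[leRHS]lnK ?posrE// ler_expR lnXn// -[ln a *+ n]mulr_natr => an.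
  rewrite ger0_norm ?subr_ge0//.
  move: nC; rewrite ltr_pdivrMr ?divr_gt0 ?subr_gt0//; lra.
have ev : eigenvalue M (expR L).
  apply: contraT => nev.
  have unit : (expR L)%:M - M \in unitmx.
    move: nev; rewrite /eigenvalue negbK /eigenspace kermx_eq0 row_free_unit => nev.
    by rewrite -opprB -scaleN1r unitmxZ// unitrN1.
  have [c [r [K0 [c0 r1 pK]]]] := invertible_exponential_growth _ (expR_gt0 L) unit rho_p.
  have r0 : 0 < r by apply: lt_trans r1.
  have lr : 0 < ln r by rewrite ln_gt0.
  have [|C pC] := pL (ln r / 2); first by rewrite divr_gt0.
  (* Chosen so that [ln c + K ln r] exceeds the allowed error [(ln r / 2) (K0 + K) + C]. *)
  pose K := (Num.truncn ((C + ln r / 2 * K0%:R - ln c) / (ln r / 2))).+1.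
  have KC : (C + ln r / 2 * K0%:R - ln c) / (ln r / 2) < K%:R by apply: truncnS_gt.
  have := pC (K0 + K)%N; have := pK K.
  rewrite -expRM_natr -[leLHS]lnK ?posrE ?mulr_gt0 ?exprn_gt0 ?expR_gt0//.
  rewrite -[leRHS]lnK ?posrE// ler_expR !lnM ?posrE ?mulr_gt0 ?exprn_gt0 ?expR_gt0//.
  rewrite expRK lnXn// -[ln r *+ K]mulr_natr => pge.
  rewrite ger0_norm ?subr_ge0//.
  move: KC pge; rewrite ltr_pdivrMr ?divr_gt0// natrD; lra.
apply/eqP; rewrite eq_le; apply/andP; split.
  by apply: ge_sup => //; exists (expR L).
by apply: ub_le_sup => //; exists (expR L).
Qed.

End nonnegative.

End PerronFrobenius.

(** * Counting paths in a finite graph by matrix powers *)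

Lemma sum_enum_val {R : nmodType} {T : finType} (f : T -> R) :
  \sum_x f x = \sum_(a < #|T|) f (enum_val a).
Proof. exact: (reindex _ (onW_bij _ (@enum_val_bij T))). Qed.

Section Paths.
Context {R : realType} {T : finType}.
Variable e : rel T.

Definition adjacency : 'M[R]_#|T| := \matrix_(a, b) (e (enum_val a) (enum_val b))%:R.

Lemma card_path_cons n x :
  #|[set w : n.+1.-tuple T | path e x w]%SET| =
  (\sum_(y | e x y) #|[set w : n.-tuple T | path e y w]%SET|)%N.
Proof.
rewrite -sum1dep_card (reindex (fun p : T * n.-tuple T => cons_tuple p.1 p.2)) /=.
  rewrite -(pair_big_dep (e x) (fun y (w : n.-tuple T) => path e y w) (fun _ _ => 1%N)).
  by apply: eq_bigr => y _; rewrite sum1dep_card.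
exists (fun w => (thead w, [tuple of behead w])) => [[y w] _|w _] /=.
  by congr pair; apply/val_inj.
by rewrite [RHS]tuple_eta; apply/val_inj.
Qed.

Lemma card_sorted_cons n :
  #|[set w : n.+1.-tuple T | sorted e w]%SET| =
  (\sum_y #|[set w : n.-tuple T | path e y w]%SET|)%N.
Proof.
rewrite -sum1dep_card (reindex (fun p : T * n.-tuple T => cons_tuple p.1 p.2)) /=.
  rewrite -(pair_big_dep xpredT (fun y (w : n.-tuple T) => path e y w) (fun _ _ => 1%N)).
  by apply: eq_bigr => y _; rewrite sum1dep_card.
exists (fun w => (thead w, [tuple of behead w])) => [[y w] _|w _] /=.
  by congr pair; apply/val_inj.
by rewrite [RHS]tuple_eta; apply/val_inj.
Qed.

Lemma sum_row_adjacency n a :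
  \sum_b (adjacency ^+ n) a b =
  #|[set w : n.-tuple T | path e (enum_val a) w]%SET|%:R :> R.
Proof.
elim: n a => [|n IH] a.
  rewrite expr0 (bigD1 a)//= big1 => [|b ba]; last by rewrite mxE eq_sym (negPf ba).
  rewrite mxE eqxx addr0 (_ : [set w | _]%SET = [set: 0.-tuple T]%SET).
    by rewrite cardsT card_tuple expn0.
  by apply/setP => w; rewrite !inE tuple0.
rewrite card_path_cons natr_sum.
transitivity (\sum_b \sum_k adjacency a k * (adjacency ^+ n) k b).
  by apply: eq_bigr => b _; rewrite exprS mxE.
rewrite exchange_big [RHS]big_mkcond /= (sum_enum_val (T := T)) /=.
apply: eq_bigr => b _; rewrite -mulr_sumr IH mxE.
by case: (e _ _); rewrite ?mul1r ?mul0r.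
Qed.

Lemma mxnorm1_adjacency n :
  mxnorm1 (adjacency ^+ n) = #|[set w : n.+1.-tuple T | sorted e w]%SET|%:R.
Proof.
rewrite card_sorted_cons natr_sum (sum_enum_val (T := T)) /=.
apply: eq_bigr => a _; rewrite -sum_row_adjacency; apply: eq_bigr => b _.
by rewrite ger0_norm// exprmx_ge0// => ? ?; rewrite mxE.
Qed.

(* Among its last [#|T| + 1] vertices the path visits one twice; running around
   that cycle forever extends the first [n + 1] vertices. *)
Lemma infinite_path n (w : (n + #|T|).+1.-tuple T) : sorted e w ->
  exists v : nat -> T, (forall k, e (v k) (v k.+1)) /\
    forall k x0, (k <= n)%N -> v k = nth x0 w k.
Proof.
move=> w_path; pose x0 := thead w.
have w_edge k : (k < n + #|T|)%N -> e (nth x0 w k) (nth x0 w k.+1).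
  by move=> kn; move/(sortedP x0): w_path; apply; rewrite size_tuple.
pose f (j : 'I_#|T|.+1) := nth x0 w (n + j).
have /injectivePn[a' [b' ab' fab']] : ~~ injectiveb f.
  by apply/negP => /injectiveP/leq_card; rewrite card_ord ltnn.
have [a [b [na ab bK wab]]] : exists a b,
    [/\ (n <= a)%N, (a < b)%N, (b <= n + #|T|)%N & nth x0 w a = nth x0 w b].
  have := ltn_ord a'; have := ltn_ord b'.
  case: (ltngtP a' b') => [h1|h1|/val_inj h1] h2 h3; last by rewrite h1 eqxx in ab'.
    by exists (n + a')%N, (n + b')%N; split=> //; lia.
  by exists (n + b')%N, (n + a')%N; split=> //; lia.
(* Follow [w] up to position [a], then cycle through the positions from [a] to [b - 1]. *)
pose idx k := if (k < a)%N then k else (a + (k - a) %% (b - a))%N.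
exists (fun k => nth x0 w (idx k)); split=> [k|k y kn]; last first.
  rewrite /idx; case: ltnP => ka; first by apply: set_nth_default; rewrite size_tuple; lia.
  have -> : k = a by lia.
  by rewrite subnn mod0n addn0; apply: set_nth_default; rewrite size_tuple; lia.
have idx_lt : (idx k < b)%N.
  have : ((k - a) %% (b - a) < b - a)%N by rewrite ltn_pmod// subn_gt0.
  by rewrite /idx; move: (_ %% _)%N => r; case: (ltnP k a); lia.
(* The indices differ only where the cycle wraps from [b] to [a], and there [w] has equal
   vertices. *)
have -> : nth x0 w (idx k.+1) = nth x0 w (idx k).+1; last by apply: w_edge; lia.
rewrite /idx; case: (ltngtP k.+1 a) => [h1|h1|h1].
- by [].
- rewrite subSn; last lia.
  have -> : ((k - a).+1 %% (b - a) = ((k - a) %% (b - a)).+1 %% (b - a))%N.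
    by rewrite -[in LHS]addn1 -modnDml addn1.
  have : ((k - a) %% (b - a) < b - a)%N by rewrite ltn_pmod// subn_gt0.
  move: (_ %% _)%N => r; rewrite leq_eqVlt => /orP[/eqP h2|h2].
    rewrite h2 modnn addn0 wab; congr nth; lia.
  by rewrite modn_small//; congr nth; lia.
- by rewrite h1 subnn mod0n addn0.
Qed.

End Paths.

(** * One-dimensional shifts of finite type and their block graphs *)

Section WindowShift.
Context {B : finType}.
Variables (m : nat) (m_gt0 : (0 < m)%N) (adm : pred (m.+1.-tuple B)).

Definition window (y : nat -> B) k n : n.-tuple B := [tuple y (k + j)%N | j < n].

Lemma nth_window x0 y k n j : (j < n)%N -> nth x0 (window y k n) j = y (k + j)%N.
Proof. by move=> jn; rewrite -[j]/(val (Ordinal jn)) -tnth_nth tnth_mktuple. Qed.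

Definition window_shift : set (nat -> B) := [set y | forall k, adm (window y k m.+1)].

(** The higher block presentation, in the form of [transition], so that its adjacency matrix is the
    transition matrix of a strip shift. *)
Definition window_edge (a b : m.-tuple B) : bool :=
  [exists w : m.+1.-tuple B, [&& take m w == a, behead w == b & adm w]].

Lemma window_edge_window y k :
  adm (window y k m.+1) -> window_edge (window y k m) (window y k.+1 m).
Proof.
move=> yk; apply/existsP; exists (window y k m.+1); rewrite yk andbT.
apply/andP; split; apply/eqP/(@eq_from_nth _ (y 0%N)).
- by rewrite size_takel size_tuple.
- move=> j; rewrite size_takel ?size_tuple// => jm.
  by rewrite nth_take// !nth_window// ltnW.
- by rewrite size_behead !size_tuple.
- move=> j; rewrite size_behead size_tuple /= => jm.
  by rewrite nth_behead !nth_window// addnS.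
Qed.

Let hd (a : m.-tuple B) := tnth a (Ordinal m_gt0).

Lemma window_edge_nth x0 a b j : window_edge a b -> (j.+1 < m)%N ->
  nth x0 a j.+1 = nth x0 b j.
Proof.
move=> /existsP[w /and3P[/eqP <- /eqP <- _]] jm.
by rewrite nth_take// nth_behead.
Qed.

(** Consecutive vertices overlap, so letter [j] of [v l] is the first letter of [v (l + j)], and
    each window is the word that labels an edge. *)
Lemma window_path (v : nat -> m.-tuple B) : (forall k, window_edge (v k) (v k.+1)) ->
  window_shift (fun k => hd (v k)).
Proof.
move=> ve k; pose x0 := hd (v 0).
have vE j l : (j < m)%N -> nth x0 (v l) j = hd (v (l + j)%N).
  elim: j l => [|j IH] l jm; first by rewrite addn0 /hd (tnth_nth x0).
  by rewrite (window_edge_nth _ _ _ _ (ve l)) // IH ?addnS// ltnW.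
have /existsP[w /and3P[/eqP wk /eqP wk1 aw]] := ve k.
rewrite (_ : window _ _ _ = w)//; apply/val_inj/(@eq_from_nth _ x0).
  by rewrite !size_tuple.
move=> j; rewrite size_tuple => jm; rewrite nth_window//.
have [jm'|mj] := ltnP j m; first by rewrite -vE// -wk nth_take.
(* The last letter of the window lies outside [v k] and is read from [v k.+1]. *)
have -> : j = m.-1.+1 by rewrite prednK//; apply/eqP; rewrite eqn_leq mj andbT -ltnS.
by rewrite -nth_behead wk1 vE ?prednK// addSnnS prednK.
Qed.

Let paths n := [set w : n.+1.-tuple (m.-tuple B) | sorted window_edge w]%SET.

(** A word extends to a point of the shift, whose first [n.+1] windows form a path; these windows
    cover the word and hence determine it. *)
Lemma card_language_le n : (#|language window_shift (n + m)| <= #|paths n|)%N.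
Proof.
have [->|[w0]] := set_0Vmem (language window_shift (n + m)); first by rewrite cards0.
rewrite inE => /asboolP[y0 _ _].
have ext (w : (n + m).-tuple B) : exists y : nat -> B, w \in language window_shift (n + m) ->
    window_shift y /\ forall k : 'I_(n + m), y k = tnth w k.
  have [|wn] := boolP (w \in _); last by exists y0.
  by rewrite inE => /asboolP[y Sy yw]; exists y.
have {ext}[Y YP] := choice ext.
pose f w := [tuple window (Y w) k m | k < n.+1].
rewrite -(@card_in_imset _ _ f).
  apply/subset_leq_card/fintype.subsetP => _ /imsetP[w /YP[Sw _] ->]; rewrite inE.
  apply/(sortedP (window y0 0 m)) => k; rewrite size_tuple => kn.
  have fE j : (j < n.+1)%N -> nth (window y0 0 m) (f w) j = window (Y w) j m.
    by move=> jn; rewrite -[j]/(val (Ordinal jn)) -tnth_nth tnth_mktuple.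
  rewrite (fE _ kn) (fE _ (ltnW kn)); exact: window_edge_window.
move=> w w' /YP[_ Yw] /YP[_ Yw'] ff'; apply: eq_from_tnth => k.
rewrite -Yw -Yw'.
have [a [j [an jm ->]]] : exists a j, [/\ (a < n.+1)%N, (j < m)%N & val k = (a + j)%N].
  have := ltn_ord k; have [kn _|nk kk] := leqP k n.
    by exists (val k), 0%N; rewrite addn0.
  by exists n, (k - n)%N; split=> //=; lia.
have := congr1 (fun t => tnth (tnth t (Ordinal an)) (Ordinal jm)) ff'.
by rewrite !tnth_mktuple.
Qed.

Let K := #|{: m.-tuple B}|.

(* A path is determined by its last [K + 1] vertices and the first letters of
   the vertices before them, and these letters extend to a point of the shift by
   [infinite_path]. *)
Lemma card_paths_le n :
  (#|paths (n + K)| <= #|language window_shift n.+1| * K ^ K.+1)%N.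
Proof.
have lt1 (k : 'I_n.+1) : (k < (n + K).+1)%N by rewrite (leq_trans (ltn_ord k))// ltnS leq_addr.
have lt2 (j : 'I_K.+1) : (n + j < (n + K).+1)%N by rewrite ltnS leq_add2l -ltnS.
pose f (w : (n + K).+1.-tuple (m.-tuple B)) :=
  ([tuple hd (tnth w (Ordinal (lt1 k))) | k < n.+1],
   [tuple tnth w (Ordinal (lt2 j)) | j < K.+1]).
rewrite -(@card_in_imset _ _ f); last first.
  move=> w w'; rewrite !inE => sw sw' ff'.
  pose t0 := thead w; pose b0 := hd t0.
  have hdE k : (k <= n)%N -> hd (nth t0 w k) = hd (nth t0 w' k).
    move=> kn; have := congr1 (fun t => tnth t.1 (Ordinal (kn : k < n.+1)%N)) ff'.
    by rewrite !tnth_mktuple !(tnth_nth t0).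
  have tlE j : (j <= K)%N -> nth t0 w (n + j) = nth t0 w' (n + j).
    move=> jK; have := congr1 (fun t => tnth t.2 (Ordinal (jK : j < K.+1)%N)) ff'.
    by rewrite !tnth_mktuple !(tnth_nth t0).
  (* Backwards from position [n]: the first letter of a vertex is known, and its other letters occur
     in the next vertex. *)
  have frE j : (j <= n)%N -> nth t0 w (n - j) = nth t0 w' (n - j).
    elim: j => [|j IH] jn; first by have := tlE 0%N isT; rewrite addn0 subn0.
    have e1 : window_edge (nth t0 w (n - j.+1)) (nth t0 w (n - j)).
      rewrite (_ : n - j = (n - j.+1).+1)%N; last lia.
      by move/(sortedP t0): sw; apply; rewrite size_tuple; lia.
    have e2 : window_edge (nth t0 w' (n - j.+1)) (nth t0 w' (n - j)).
      rewrite (_ : n - j = (n - j.+1).+1)%N; last lia.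
      by move/(sortedP t0): sw'; apply; rewrite size_tuple; lia.
    apply/val_inj/(@eq_from_nth _ b0); first by rewrite !size_tuple.
    move=> [|l]; rewrite size_tuple => lm.
      by have := hdE _ (leq_subr j.+1 n); rewrite /hd !(tnth_nth b0).
    by rewrite (window_edge_nth _ _ _ _ e1)// (window_edge_nth _ _ _ _ e2)// IH// ltnW.
  apply/val_inj/(@eq_from_nth _ t0); first by rewrite !size_tuple.
  move=> k; rewrite size_tuple => kK.
  have [kn|nk] := leqP k n; first by rewrite -(subKn kn) frE// leq_subr.
  by rewrite -(subnKC (ltnW nk)) tlE//; lia.
have <- : #|finset.setX (language window_shift n.+1) [set: K.+1.-tuple (m.-tuple B)]%SET| =
    (#|language window_shift n.+1| * K ^ K.+1)%N.
  by rewrite cardsX cardsT card_tuple.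
apply/subset_leq_card/fintype.subsetP => ? /imsetP[w].
rewrite inE => /infinite_path[v [ve vw]] ->; rewrite !inE andbT.
apply/asboolP; exists (fun k => hd (v k)); first exact: window_path.
move=> k; rewrite tnth_mktuple (tnth_nth (thead w)) -vw//=.
by rewrite -ltnS ltn_ord.
Qed.

Lemma language_window_shift0 n : language window_shift n = finset.set0 ->
  window_shift = set0.
Proof.
move=> L0; apply/seteqP; split=> // y Sy.
have : window y 0 n \in language window_shift n.
  by rewrite inE; apply/asboolP; exists y => // k; rewrite tnth_mktuple.
by rewrite L0 inE.
Qed.

(** Words and paths bound each other up to index shifts and the factor [K ^ K.+1], so words inherit
    the Perron-Frobenius rate. *)
Lemma language_asymp_linear {R : realType} :
  asymp_linear (fun n => ln #|language window_shift n|%:R)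
    (ln (largest_eigenvalue (adjacency window_edge : 'M[R]_ _))).
Proof.
(* For the empty shift no path has [K.+1] vertices, so the matrix is nilpotent; both logarithms are
   then [ln 0], which is 0 by convention. *)
have [S0|S0] := eqVneq window_shift set0.
  have L0 n : #|language window_shift n| = 0%N.
    apply/eqP; rewrite cards_eq0; apply/eqP/setP => w; rewrite !inE.
    by apply/asboolP => -[y]; rewrite S0.
  have MK0 : (adjacency window_edge : 'M[R]_ _) ^+ K = 0.
    apply: mxnorm1_eq0; rewrite mxnorm1_adjacency; apply/eqP.
    rewrite pnatr_eq0 -leqn0 (leq_trans (card_paths_le 0))//.
    by rewrite L0 mul0n.
  rewrite (largest_eigenvalue_nilpotent _ _ _ MK0) ln0// => e e0.
  by exists 0 => n; rewrite L0 ln0// mul0r subr0 normr0 addr0 mulr_ge0// ltW.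
have L1 n : (0 < #|language window_shift n|)%N.
  by rewrite card_gt0; apply: contra_neq S0; exact: language_window_shift0.
have P1 n : (0 < #|paths n|)%N by rewrite (leq_trans (L1 _) (card_language_le n)).
have K1 : (0 < K)%N.
  have /card_gt0P[w _] := P1 0%N; apply/card_gt0P; by exists (thead w).
apply: (@asymp_linear_sandwich _ _ _ _ (ln (K ^ K.+1)%:R) m K 1%N); last first.
- apply: perron_frobenius_rate => [a b|n]; first by rewrite mxE.
  by rewrite mxnorm1_adjacency ler1n.
- move=> n /=; rewrite mxnorm1_adjacency addn1 -lnM ?posrE ?ltr0n ?expn_gt0 ?K1//.
  rewrite ler_ln ?posrE -?natrM ?ltr0n ?muln_gt0 ?L1 ?P1 ?expn_gt0 ?K1//.
  by rewrite ler_nat card_paths_le.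
- move=> n /=; rewrite mxnorm1_adjacency ler_wpDr ?ln_ge0 ?ler1n ?expn_gt0 ?K1//.
  by rewrite ler_ln ?posrE ?ltr0n// ler_nat card_language_le.
Qed.

End WindowShift.

(** * Strip shifts as one-dimensional shifts of finite type *)

Section StripShift.
Context {A : finType}.
Variables (F : {fset {fmap nat * nat -> A}}) (d : direction) (i : nat).

Definition admissible_window : pred ((memory F d).+1.-tuple {ffun 'I_i -> A}) :=
  fun w => `[< admissible F (stack d (onth w)) >].

Lemma alongD r s : along d (r + s) = along d r + along d s.
Proof. by case: d. Qed.

Lemma alongK : involutive (along d).
Proof. by case: d => -[]. Qed.

Lemma onth_window (y : nat -> {ffun 'I_i -> A}) k n j :
  onth (window y k n) j = if (j < n)%N then Some (y (k + j)%N) else None.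
Proof.
have [jn|nj] := ltnP j n; last by rewrite onth_default// size_tuple.
by apply/(tnth_onth _ _ (Ordinal jn)); rewrite tnth_mktuple.
Qed.

Lemma extent_ge (p : {fmap nat * nat -> A}) s s' : p \in F -> s \in domf p ->
  s' \in domf p -> ((along d s).1 - (along d s').1 <= extent F d)%N.
Proof.
move=> pF sp sp'.
rewrite /extent; apply: leq_trans (leq_bigmax_seq p _ _) => //.
apply: leq_trans (leq_bigmax_seq s _ _) => //.
exact: (leq_bigmax_seq s' _ _).
Qed.

(** An occurrence of a forbidden pattern spans at most [extent F d + 1] cross-sections, so it fits
    in the window starting at its first one. *)
Lemma strip_shift_window : strip_shift F d (i := i) = window_shift _ admissible_window.
Proof.
apply/seteqP; split=> y Sy.
  move=> k; apply/asboolP => p pF [u [w occ]]; apply: (Sy p pF).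
  exists (u + along d (k, 0%N)), w => s sp; have [r [rw gr]] := occ s sp.
  exists (r + along d (k, 0%N)); split; first by rewrite addrAC rw addrA.
  move: gr; rewrite /stack alongD alongK onth_window /=.
  case: ifP => [_|_]; last first.
    by move: sp; rewrite -fndSome; case: (p.[? s])%fmap.
  by rewrite addr0 [(_ + k)%R]addnC.
move=> p pF [u [w occ]].
(* The empty pattern occurs everywhere and has no first cross-section; any window already excludes
   it. *)
have [p0|/fset0Pn[s0' s0'p]] := eqVneq (domf p) fset0.
  have /asboolP/(_ p pF) := Sy 0%N; apply.
  by exists 0, 0 => s sp; exfalso; move: sp; rewrite p0 inE.
have [s0 _ s0_min] := @arg_minnP _ [` s0'p]%fset xpredT (fun s => (along d (val s)).1) isT.
have pos s r : r + w = s + u ->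
    ((along d r).1 + (along d w).1 = (along d s).1 + (along d u).1)%N.
  by move=> /(congr1 (fun z => (along d z).1)); rewrite !alongD.
have [r0 [/pos r0w _]] := occ (val s0) (valP s0).
pose k := (along d r0).1.
have /asboolP/(_ p pF) := Sy k; apply.
(* Adding [k] to [w] re-bases the occurrence so that [r0] falls in cross-section 0 of the window. *)
exists u, (w + along d (k, 0%N)) => s sp; have [r [rw gr]] := occ s sp.
have s0s : ((along d (val s0)).1 <= (along d s).1)%N := s0_min [` sp]%fset isT.
have kr : (k <= (along d r).1)%N.
  by have := pos _ _ rw; rewrite /k; lia.
have rk : ((along d r).1 - k < (memory F d).+1)%N.
  rewrite ltnS (leq_trans _ (leq_maxr _ _))//.
  apply: leq_trans (extent_ge _ _ _ pF sp (valP s0)).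
  by have := pos _ _ rw; rewrite /k; lia.
exists (along d ((along d r).1 - k, (along d r).2)%N); split.
  rewrite addrA [_ + w]addrC -addrA -rw addrC -alongD; congr (_ + w).
  rewrite -[RHS]alongK; congr along; rewrite [RHS]surjective_pairing.
  by congr pair; [exact: subnK|exact: addn0].
by rewrite -gr /stack alongK /= onth_window rk subnKC.
Qed.

Lemma ln_language_asymp_linear {R : realType} :
  asymp_linear (fun n => ln #|language (strip_shift F d (i := i)) n|%:R)
    (ln (largest_eigenvalue (transition_matrix R F d i))).
Proof.
rewrite strip_shift_window.
apply: language_asymp_linear; exact: leq_maxl.
Qed.

End StripShift.

(** * Counting patterns on boxes and on unions of translates *)

Lemma mem_box m k (s : nat * nat) : (s \in box m k) = (s.1 < m)%N && (s.2 < k)%N.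
Proof. by rewrite inE /= !inE !mem_iota. Qed.

Lemma card_box m k : #|` box m k| = (m * k)%N.
Proof.
pose s := [seq (a, b) | a <- iota 0 m, b <- iota 0 k].
have s_uniq : uniq s by apply: allpairs_uniq => [||[? ?] [? ?]]//; rewrite iota_uniq.
rewrite -[RHS](_ : size s = _); last by rewrite size_allpairs !size_iota.
apply/perm_size/uniq_perm => // -[a b]; rewrite mem_box /=.
apply/idP/allpairsP => [/andP[am bk]|[[a' b'] /= []]].
  by exists (a, b); rewrite !mem_iota.
by rewrite !mem_iota => am bk [-> ->]; apply/andP.
Qed.

Section Patterns.
Context {A : finType}.
Variables (X : set (nat * nat -> A)).

Definition restrict (D : {fset nat * nat}) (x : nat * nat -> A) : {ffun D -> A} :=
  [ffun s => x (val s)].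

Lemma mem_restrict D x : X x -> restrict D x \in patterns D X.
Proof. by move=> Xx; rewrite inE; apply/asboolP; exists x => // s; rewrite ffunE. Qed.

Lemma patterns_restrict D u : u \in patterns D X -> exists2 x, X x & u = restrict D x.
Proof.
rewrite inE => /asboolP[x Xx xu]; exists x => //.
by apply/ffunP => s; rewrite ffunE -xu.
Qed.

Lemma card_patterns_gt0 D : (0 < #|patterns D X|)%N <-> X !=set0.
Proof.
split=> [/card_gt0P[u /patterns_restrict[x Xx _]]|[x Xx]]; first by exists x.
by apply/card_gt0P; exists (restrict D x); apply: mem_restrict.
Qed.

(** A pattern on [D] is determined by its restrictions to the two translates; shift invariance turns
    these into patterns on [D1] and [D2]. *)
Lemma card_patterns_cover D D1 D2 (t1 t2 : nat * nat) :
  (forall t x, X x -> X (fun s => x (s + t))) ->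
  (forall s, s \in D -> (exists2 s1, s1 \in D1 & s = s1 + t1) \/
                        (exists2 s2, s2 \in D2 & s = s2 + t2)) ->
  (#|patterns D X| <= #|patterns D1 X| * #|patterns D2 X|)%N.
Proof.
move=> Xshift cover.
have [->|[u0 /patterns_restrict[x0 _ _]]] := set_0Vmem (patterns D X).
  by rewrite cards0.
have ext u : exists x, u \in patterns D X -> X x /\ u = restrict D x.
  have [/patterns_restrict[x Xx ux]|] := boolP (u \in patterns D X); first by exists x.
  by exists x0.
have {ext}[Y YP] := choice ext.
pose f u := (restrict D1 (fun s => Y u (s + t1)), restrict D2 (fun s => Y u (s + t2))).
rewrite -cardsX -(@card_in_imset _ _ f).
  apply/subset_leq_card/fintype.subsetP => _ /imsetP[u /YP[Xu _] ->].
  by rewrite finset.in_setX; apply/andP; split; apply: mem_restrict; apply: Xshift.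
move=> u v /YP[_ {2}->] /YP[_ {2}->] [f1 f2]; apply/ffunP => s; rewrite !ffunE.
have [[s1 s1D ->]|[s2 s2D ->]] := cover _ (valP s).
  by have := congr1 (fun g : {ffun D1 -> A} => g [` s1D]%fset) f1; rewrite !ffunE.
by have := congr1 (fun g : {ffun D2 -> A} => g [` s2D]%fset) f2; rewrite !ffunE.
Qed.

(** Each pair of patterns is realized by one point, and the restriction of that point to [D]
    recovers the pair. *)
Lemma card_patterns_glue D D1 D2 (t1 t2 : nat * nat) :
  (forall s, s \in D1 -> s + t1 \in D) -> (forall s, s \in D2 -> s + t2 \in D) ->
  (forall x1 x2, X x1 -> X x2 -> exists2 x, X x &
     (forall s, s \in D1 -> x (s + t1) = x1 s) /\
     (forall s, s \in D2 -> x (s + t2) = x2 s)) ->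
  (#|patterns D1 X| * #|patterns D2 X| <= #|patterns D X|)%N.
Proof.
move=> D1D D2D glue.
have [->|[u0 /patterns_restrict[x0 Xx0 _]]] := set_0Vmem (patterns D1 X).
  by rewrite cards0.
have ext (u : {ffun D1 -> A} * {ffun D2 -> A}) : exists x,
    u \in finset.setX (patterns D1 X) (patterns D2 X) ->
    [/\ X x, u.1 = restrict D1 (fun s => x (s + t1)) &
        u.2 = restrict D2 (fun s => x (s + t2))].
  case: u => u1 u2; have [|] := boolP ((u1, u2) \in _); last by exists x0.
  rewrite finset.in_setX => /andP[/patterns_restrict[x1 Xx1 ->] /patterns_restrict[x2 Xx2 ->]].
  have [x Xx [xx1 xx2]] := glue _ _ Xx1 Xx2; exists x => _; split=> //.
    by apply/ffunP => s; rewrite !ffunE xx1// (valP s).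
  by apply/ffunP => s; rewrite !ffunE xx2// (valP s).
have {ext}[Y YP] := choice ext.
rewrite -cardsX -(@card_in_imset _ _ (fun u => restrict D (Y u))).
  apply/subset_leq_card/fintype.subsetP => _ /imsetP[u /YP[Xu _ _] ->].
  exact: mem_restrict.
move=> [u1 u2] [v1 v2] /YP[_ /= u1E u2E] /YP[_ /= v1E v2E] uv.
have {}uv s : s \in D -> Y (u1, u2) s = Y (v1, v2) s.
  by move=> sD; have := congr1 (fun g : {ffun D -> A} => g [` sD]%fset) uv; rewrite !ffunE.
congr pair; apply/ffunP => s.
  by rewrite u1E v1E !ffunE uv//; exact/D1D/valP.
by rewrite u2E v2E !ffunE uv//; exact/D2D/valP.
Qed.

End Patterns.

Lemma sft_shift {A : finType} (F : {fset {fmap nat * nat -> A}}) t x :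
  sft F x -> sft F (fun s => x (s + t)).
Proof.
move=> Fx p pF [u [w occ]]; apply: (Fx p pF); exists (u + t), w => s sp.
have [r [rw <-]] := occ s sp; exists (r + t); split=> //.
by rewrite addrAC rw addrA.
Qed.

(** * Side lengths and size of the boundary region *)

Section BoundaryRegion.
Context {R : realType}.

Definition outer_side (x : R) (i n : nat) := Num.truncn (Num.max (x * n%:R) i%:R).

Lemma outer_side_ge x i n : (i <= outer_side x i n)%N.
Proof. by rewrite truncn_ge_nat ?le_max ?lexx ?orbT// ler0n orbT. Qed.

(** Truncation commutes with subtracting an integer; if [x n <= i], the maximum makes the outer side
    [i] and both members vanish. *)
Lemma inner_side x i n : Num.truncn (x * n%:R - i%:R) = (outer_side x i n - i)%N.
Proof.
rewrite /outer_side; set y := x * n%:R.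
have [yi|iy] := leP y i%:R.
  rewrite natrK subnn; apply/eqP; rewrite -leqn0 truncn_le_nat.
  by rewrite (le_lt_trans _ (ltr01))// subr_le0.
have y0 : 0 <= y by rewrite (le_trans _ (ltW iy)).
have iM : (i <= Num.truncn y)%N by rewrite truncn_ge_nat// ltW.
have := truncn_itv y0; rewrite -natr1 => /andP[My yM].
by apply: truncn_def; rewrite -natr1 natrB//; apply/andP; split; lra.
Qed.

Lemma outer_side_bound x i n : 0 <= x ->
  `|(outer_side x i n)%:R - x * n%:R| <= i%:R + 1.
Proof.
move=> x0; rewrite /outer_side; set y := x * n%:R.
have y0 : 0 <= y by rewrite mulr_ge0.
have m0 : 0 <= Num.max y i%:R by rewrite le_max y0.
have /andP[] := truncn_itv m0; rewrite -natr1.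
have i0 : 0 <= i%:R :> R by [].
by case: (leP y i%:R) => yi a b; rewrite ler_norml; apply/andP; split; lra.
Qed.

Lemma boundary_regionE (t : R) i n : boundary_region t i n =
  let m := outer_side t i n in let k := outer_side (1 - t) i n in
  (box m k `\` box (m - i) (k - i))%fset.
Proof. by rewrite /boundary_region /real_box !inner_side. Qed.

Lemma card_boundary_region (t : R) i n :
  #|` boundary_region t i n| =
  (i * (outer_side t i n + outer_side (1 - t) i n) - i * i)%N.
Proof.
rewrite boundary_regionE /=.
rewrite cardfsDS ?card_box; last first.
  apply/fsubsetP => s; rewrite !mem_box => /andP[sm sk].
  by rewrite (leq_trans sm) ?(leq_trans sk)// leq_subr.
move: (outer_side_ge t i n) (outer_side_ge (1 - t) i n).
move: (outer_side t i n) (outer_side _ i n) => m k /subnK <- /subnK <-.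
by rewrite !addnK; move: (m - i)%N (k - i)%N => a b; nia.
Qed.

End BoundaryRegion.

(** * Splitting the boundary region into two strips *)

Section BoundaryPatterns.
Context {A : finType}.

Lemma block_gluing_points (N : nat) (X : set (nat * nat -> A)) m k m' k' (v v' : nat * nat) :
  block_gluing N X ->
  (forall s s', s \in box m k -> s' \in box m' k' -> (N <= site_dist (s + v)%R (s' + v')%R)%N) ->
  forall x1 x2, X x1 -> X x2 -> exists2 x, X x &
    (forall s, s \in box m k -> x (s + v) = x1 s) /\
    (forall s, s \in box m' k' -> x (s + v') = x2 s).
Proof.
move=> glue dist x1 x2 Xx1 Xx2.
pose u1 := [ffun s : 'I_m * 'I_k => x1 (val s.1, val s.2)].
pose u2 := [ffun s : 'I_m' * 'I_k' => x2 (val s.1, val s.2)].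
have [||[s1 s2] [s1' s2']|x Xx [xu1 xu2]] := glue _ _ _ _ u1 u2 v v'.
- by exists x1 => //; exists (0%N, 0%N) => s; rewrite ffunE.
- by exists x2 => //; exists (0%N, 0%N) => s; rewrite ffunE.
- have := dist (val s1, val s2) (val s1', val s2').
  rewrite !mem_box /= !ltn_ord => /(_ isT isT).
  by rewrite /site_dist /= ![(_ + v.1)%R]addnC ![(_ + v.2)%R]addnC
    ![(_ + v'.1)%R]addnC ![(_ + v'.2)%R]addnC.
exists x => //; split=> -[a b]; rewrite mem_box => /andP[/= am bk].
  by have := xu1 (Ordinal am, Ordinal bk); rewrite ffunE /= => <-; rewrite addrC.
by have := xu2 (Ordinal am, Ordinal bk); rewrite ffunE /= => <-; rewrite addrC.
Qed.

Variables (F : {fset {fmap nat * nat -> A}}) (N i : nat).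

(** The horizontal strip is the top of the box and the vertical one its right edge; they overlap in
    an [i] by [i] corner, harmless for an upper bound. *)
Lemma card_patterns_L_le m k : (i <= m)%N -> (i <= k)%N ->
  (#|patterns (box m k `\` box (m - i) (k - i))%fset (sft F)| <=
   #|patterns (box m i) (sft F)| * #|patterns (box i k) (sft F)|)%N.
Proof.
move=> im ik.
apply: (card_patterns_cover _ _ _ _ (0%N, k - i)%N (m - i, 0)%N); first exact: sft_shift.
move=> [a b]; rewrite in_fsetD !mem_box /= negb_and -!leqNgt.
move=> /andP[inner /andP[am bk]].
have [kib|bki] := leqP (k - i) b; [left|right].
  exists (a, b - (k - i))%N; first by rewrite mem_box /= am; lia.
  by congr pair; [rewrite [RHS]addn0|rewrite [RHS]subnK].
have mia : (m - i <= a)%N by move: inner; rewrite [(k - i <= b)%N]leqNgt bki orbF.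
exists (a - (m - i), b)%N; first by rewrite mem_box /= bk andbT; lia.
by congr pair; [rewrite [RHS]subnK|rewrite [RHS]addn0].
Qed.

(** Of the length [i + N] cut from the vertical strip, [i] removes the common corner and [N] creates
    the vertical gap that gluing requires. If [k <= i + N], the shortened strip is empty and the
    distance condition vacuous. *)
Lemma card_patterns_L_ge m k : block_gluing N (sft F) -> (i <= m)%N -> (i <= k)%N ->
  (#|patterns (box m i) (sft F)| * #|patterns (box i (k - (i + N))) (sft F)| <=
   #|patterns (box m k `\` box (m - i) (k - i))%fset (sft F)|)%N.
Proof.
move=> glue im ik.
apply: (card_patterns_glue _ _ _ _ (0%N, k - i)%N (m - i, 0)%N).
- move=> [a b]; rewrite in_fsetD !mem_box => /andP[/= am bi].
  rewrite [(a + 0)%R]addn0 [(b + _)%R]addnC am negb_and -!leqNgt leq_addr orbT /=; lia.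
- move=> [a b]; rewrite in_fsetD !mem_box => /andP[/= ai bk].
  rewrite [(b + 0)%R]addn0 [(a + _)%R]addnC negb_and -!leqNgt leq_addr /=; lia.
apply: (block_gluing_points _ _ _ _ _ _ _ _ glue) => -[a b] [a' b'].
rewrite !mem_box => /andP[/= _ bi] /andP[_ b'k].
rewrite /site_dist /= leq_max; apply/orP; right.
rewrite [(b' + 0)%R]addn0 [(b + _)%R]addnC; lia.
Qed.

End BoundaryPatterns.

(** * The limit of the boundary rate *)

Section BoundaryRate.
Context {R : realType} {A : finType}.
Variables (F : {fset {fmap nat * nat -> A}}) (N i : nat).
Hypotheses (i_gt0 : (0 < i)%N) (gluing : block_gluing N (sft F)).

Let a n : R := ln #|patterns (box n i) (sft F)|%:R.
Let b n : R := ln #|patterns (box i n) (sft F)|%:R.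

Lemma ln_card_boundary_bounds (t : R) n :
  let m := outer_side t i n in let k := outer_side (1 - t) i n in
  a m + b (k - (i + N)) <= ln #|patterns (boundary_region t i n) (sft F)|%:R
    <= a m + b k.
Proof.
rewrite boundary_regionE /=.
have im := outer_side_ge t i n; have ik := outer_side_ge (1 - t) i n.
move: (outer_side t i n) (outer_side _ i n) im ik => m k im ik.
(* For empty [X] all three terms are 0, since [ln 0] is 0. *)
have [X0|/set0P/card_patterns_gt0 X0] := eqVneq (sft F) set0.
  have P0 D : #|patterns D (sft F)| = 0%N.
    apply/eqP; rewrite -leqn0 leqNgt; apply/negP => /card_patterns_gt0.
    by rewrite X0 => -[].
  by rewrite /a /b !P0 ln0// addr0 lexx.
rewrite /a /b -!lnM ?posrE ?ltr0n// -!natrM.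
rewrite !ler_ln ?posrE ?ltr0n ?muln_gt0 ?X0// !ler_nat.
by rewrite card_patterns_L_le// card_patterns_L_ge.
Qed.

Lemma boundary_rate_cvg alpha beta t : 0 <= t <= 1 ->
  asymp_linear a alpha -> asymp_linear b beta ->
  boundary_rate t i (sft F) n @[n --> \oo] -->
    (alpha * t + beta * (1 - t)) / i%:R.
Proof.
move=> /andP[t0 t1] aL bL.
have t1' : 0 <= 1 - t by rewrite subr_ge0.
have mt n := @outer_side_bound R t i n t0.
have kt n := @outer_side_bound R (1 - t) i n t1'.
have i0 : 0 <= i%:R :> R by [].
have num : asymp_linear
    (fun n => ln #|patterns (boundary_region t i n) (sft F)|%:R)
    (alpha * t + beta * (1 - t)).
  apply: (asymp_linear_squeeze _ _ _ _ _ _ (ln_card_boundary_bounds t)).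
    apply: asymp_linearD; first exact: asymp_linear_comp mt.
    (* Cutting off [i + N] changes the length by a bounded amount, so the lower bound has the same
       slope. *)
    apply: (asymp_linear_comp b beta (fun n => outer_side (1 - t) i n - (i + N))%N _
      (i%:R + 1 + (i + N)%:R)) => // n.
    have := kt n; move: (outer_side _ _ _) => k; rewrite !ler_norml => /andP[k1 k2].
    have : (k - (i + N))%:R <= k%:R :> R by rewrite ler_nat leq_subr.
    have : k%:R <= (k - (i + N))%:R + (i + N)%:R :> R by rewrite -natrD ler_nat; lia.
    have : 0 <= (i + N)%:R :> R by [].
    by move=> *; apply/andP; split; lra.
  by apply: asymp_linearD; [exact: asymp_linear_comp mt|exact: asymp_linear_comp kt].
have den : asymp_linear (fun n => #|` boundary_region t i n|%:R : R) i%:R.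
  (* The two sides add up to [n] within [2 (i + 1)]; this error is multiplied by [i], and the corner
     contributes [i * i]. *)
  apply: (asymp_linear_bounded _ _ (2 * i%:R * (i%:R + 1) + i%:R * i%:R)) => n.
  have im := outer_side_ge t i n.
  rewrite card_boundary_region natrB ?leq_mul2l ?(leq_trans im) ?leq_addr ?orbT//.
  rewrite !natrM natrD; have := mt n; have := kt n.
  move: (outer_side _ _ _)%:R (outer_side _ _ _)%:R => k m.
  rewrite !ler_norml => /andP[k1 k2] /andP[m1 m2].
  by apply/andP; split; nra.
have /asymp_linear_cvg num_cvg := num.
have /asymp_linear_cvg den_cvg := den.
have iN0 : i%:R != 0 :> R by rewrite pnatr_eq0 -lt0n.
apply: cvg_trans (cvgM num_cvg (cvgV iN0 den_cvg)).
apply: near_eq_cvg; exists 1%N => // n /= n1.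
have n0 : n%:R != 0 :> R by rewrite pnatr_eq0 -lt0n.
by rewrite /boundary_rate /= invf_div mulrA mulfVK.
Qed.

End BoundaryRate.

(** * Choice of the parameter and conclusion *)

Lemma between_convex {R : realType} (x y h : R) : Num.min x y <= h <= Num.max x y ->
  exists2 t, 0 <= t <= 1 & h = (1 - t) * y + t * x.
Proof.
move=> /andP[]; have [->|xy] := eqVneq x y.
  move=> yh hy.
  exists 0; rewrite ?lexx ?ler01// subr0 mul1r mul0r addr0.
    by move: yh hy; rewrite minxx maxxx => yh hy; apply/eqP; rewrite eq_le hy yh.
move=> minh maxh; exists ((h - y) / (x - y)); last by field; rewrite subr_eq0.
move: minh maxh; case: (ltgtP x y) xy => // xy _ xh hy.
  by rewrite ler_ndivlMr ?ler_ndivrMr ?subr_lt0// mul0r mul1r; apply/andP; split; lra.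
by rewrite ler_pdivlMr ?ler_pdivrMr ?subr_gt0// mul0r mul1r; apply/andP; split; lra.
Qed.

(** The hypothesis makes the two logarithmic counts differ by [o(n)], so the rate of the strip shift
    passes to the patterns of [X]. *)
Lemma ln_patterns_strip_asymp_linear {R : realType} {A : finType}
    (F : {fset {fmap nat * nat -> A}}) d i :
  strip_entropy_agrees R F d i ->
  asymp_linear (fun n => ln #|patterns (strip_box d i n) (sft F)|%:R)
    (ln (largest_eigenvalue (transition_matrix R F d i))).
Proof.
move=> /asymp_linear_cvg agrees.
have := asymp_linearD _ _ _ _ agrees (ln_language_asymp_linear F d i).
by rewrite add0r; congr asymp_linear; apply/funext => n; rewrite subrK.
Qed.

Theorem corollary2p9 (R : realType) (A : finType)
    (F : {fset {fmap nat * nat -> A}}) (N i : nat)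
    (i_ge1 : (1 <= i)%N)
    (gluing : block_gluing N (sft F))
    (entropyH : strip_entropy_agrees R F horizontal i)
    (entropyV : strip_entropy_agrees R F vertical i)
    (h : R) :
  let lambdaH := largest_eigenvalue (transition_matrix R F horizontal i) in
  let lambdaV := largest_eigenvalue (transition_matrix R F vertical i) in
  Num.min (ln lambdaH / i%:R) (ln lambdaV / i%:R) <= h
    <= Num.max (ln lambdaH / i%:R) (ln lambdaV / i%:R) ->
  exists t : R,
    [/\ 0 <= t <= 1,
        boundary_rate t i (sft F) n @[n --> \oo] --> h
      & h = (1 - t) / i%:R * ln lambdaV + t / i%:R * ln lambdaH].
Proof.
move=> lambdaH lambdaV /between_convex[t t01 ht].
have hE : h = (ln lambdaH * t + ln lambdaV * (1 - t)) / i%:R by rewrite ht; ring.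
exists t; split=> //; last by rewrite hE; ring.
rewrite hE; apply: (boundary_rate_cvg _ _ _ i_ge1 gluing) => //.
  exact: (ln_patterns_strip_asymp_linear _ horizontal).
exact: (ln_patterns_strip_asymp_linear _ vertical).
Qed.
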